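(* Let $k\ge 2$ be an integer, and for a natural number $N\ge 1$ let $\beta(N)=(d_i(N))_{i\in\mathbb{Z}}$ be its base phi representation. Then $d_k(N)=1$ if and only if $N$ is a member of one of the sequences $(\lfloor n\varphi\rfloor L_k+nL_{k-1}+r)_{n\ge 1}$ with $r\in\{r_1,\,r_1+1,\dots,r_1+|\Lambda_k|-1\}$, where $r_1=-L_{k-1}$ if $k$ is even, and $r_1=-L_{k-1}+1$ if $k$ is odd.
   Context: Let $\varphi=(1+\sqrt5)/2$ be the golden mean. Every natural number $N\ge 1$ can be written in exactly one way as $N=\sum_{i=-\infty}^{\infty}d_i\varphi^i$ with digits $d_i\in\{0,1\}$, only finitely many of them nonzero, such that $d_id_{i+1}=0$ for all $i\in\mathbb{Z}$. This is called the base phi representation of $N$; its digits are denoted $d_i(N)$, and one writes $\beta(N)=(d_i(N))$. Here $\lfloor\cdot\rfloor$ denotes the floor function. The Lucas numbers are defined by $L_0=2$, $L_1=1$, $L_n=L_{n-1}+L_{n-2}$ for $n\ge 2$. The Lucas intervals are the sets of integers $\Lambda_{2n}=[L_{2n},L_{2n+1}]$ and $\Lambda_{2n+1}=[L_{2n+1}+1,\,L_{2n+2}-1]$ (endpoints included), for $n\ge 1$, and $|\Lambda_k|$ denotes the number of integers in $\Lambda_k$; thus $|\Lambda_{2n}|=L_{2n-1}+1$ and $|\Lambda_{2n+1}|=L_{2n}-1$. *)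

(* Defs.v *)
From HB Require Import structures.
From mathcomp Require Import all_boot all_order all_algebra.
From mathcomp Require Import all_classical all_reals.

Set Implicit Arguments.
Unset Strict Implicit.
Unset Printing Implicit Defensive.

Import Order.TTheory GRing.Theory Num.Theory.
Local Open Scope classical_set_scope.
Local Open Scope ring_scope.

Definition phi (R : realType) : R := (1 + Num.sqrt 5) / 2.

(* Without the finite support condition the sum over [set: int] would be 0
   by convention. *)
Definition base_phi_representation (R : realType) (N : nat) (d : int -> nat) :=
  [/\ forall i, d i = 0%N \/ d i = 1%N,
      forall i, (d i * d (i + 1)%R = 0)%N,
      finite_set [set i | d i <> 0%N]
    & N%:R = \sum_(i \in [set: int]) (d i)%:R * phi R ^ i].

Fixpoint lucas (n : nat) : nat :=
  match n with
  | 0 => 2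
  | 1 => 1
  | (m.+1 as p).+1 => (lucas p + lucas m)%N
  end.

(* [L_k, L_(k+1)] for k even, [L_k + 1, L_(k+1) - 1] for k odd, as increasing
   lists; index_iota excludes its right endpoint. Only k >= 2 is meaningful. *)
Definition lucas_interval (k : nat) : seq nat :=
  if odd k then index_iota (lucas k).+1 (lucas k.+1)
  else index_iota (lucas k) (lucas k.+1).+1.

Definition r1 (k : nat) : int :=
  if odd k then - (lucas k.-1)%:Z + 1 else - (lucas k.-1)%:Z.

(* Main.v *)
Require Import Defs.
From HB Require Import structures.
From mathcomp Require Import all_boot all_order all_algebra.
From mathcomp Require Import all_classical all_reals.
From mathcomp Require Import zify ring lra.

Set Implicit Arguments.
Unset Strict Implicit.
Unset Printing Implicit Defensive.

Import Order.TTheory GRing.Theory Num.Theory.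
Local Open Scope ring_scope.

(** The digit d_k(N) is read off from the position of N among the lattice
    points of Z[phi]. Write phi' = 1 - phi for the conjugate of phi. Cutting
    the expansion of N at the index k gives N = phi^k S + phi^(k-1) T, where S
    is a finite expansion in nonnegative powers of phi with lowest digit
    d_k(N), and 0 <= T < phi, with even T < 1 when d_k(N) = 1, since then
    d_(k-1)(N) = 0.

    S is a lattice point p phi + q, and the absence of adjacent ones confines
    its conjugate S' = p phi' + q to ]phi - 1, phi[ if d_k(N) = 1 and to ]-1,
    phi - 1[ if d_k(N) = 0 ([conj_expansion_bounds]). The first window has
    length 1, so it determines q from p: the lattice points in it with p >= 0
    are exactly a_n = floor(n phi) + (n - 1) / phi with n = p + 1 >= 1. Hence
    d_k(N) = 1 forces N to lie in some interval [phi^k a_n, phi^k a_n +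
    phi^(k-1)[. Conversely, if N lies in this interval but d_k(N) = 0, then S -
    a_n would be a nonexistent lattice point: its value and its conjugate would
    lie in a pair of windows that no lattice point fits
    ([lattice_window_separation]). This is [digit_intervalP].

    The Lucas identity L_k = phi^k + phi'^k turns the endpoints of these
    intervals into floor(n phi) L_k + n L_(k-1), up to errors that are
    multiples of phi'^k, nonzero and smaller than 1 in absolute value. So the
    integers of the interval are obtained by rounding, and the parity of k,
    which is the sign of phi'^k, decides in which direction
    ([lucas_intervalE]). *)

(** * The golden mean *)

Lemma phi_sqr (R : realType) : phi R ^+ 2 = phi R + 1.
Proof.
have : Num.sqrt 5 ^+ 2 = 5 :> R by rewrite sqr_sqrtr.
rewrite /phi; move: (Num.sqrt 5) => s hs.
have -> : ((1 + s) / 2) ^+ 2 = (1 + 2 * s + s ^+ 2) / 4 by field.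
by rewrite hs; field.
Qed.

Lemma phi_bounds (R : realType) : 1 < phi R < 2.
Proof.
have hs : Num.sqrt 5 ^+ 2 = 5 :> R by rewrite sqr_sqrtr.
have s0 : 0 <= Num.sqrt 5 :> R by rewrite sqrtr_ge0.
by rewrite /phi; move: (Num.sqrt 5) hs s0 => s hs s0; apply/andP; split; nra.
Qed.

(** A relation n phi = m gives (2 m - n)^2 = 5 n^2, where the exponents of 5
    on the two sides have different parities. *)
Lemma phi_irrational (R : realType) (n : nat) (m : int) :
  (0 < n)%N -> n%:R * phi R <> m%:~R.
Proof.
move=> n0 nphi.
have nrm : (m ^+ 2 = m * n%:Z + n%:Z ^+ 2)%R.
  apply: (@intr_inj R); rewrite rmorphD rmorphM !rmorphXn /= -nphi.
  rewrite !pmulrn; have := phi_sqr R; move: (phi R) => f ff.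
  by ring: ff.
pose x := absz (2 * m - n%:Z)%R.
have x2 : (x ^ 2 = 5 * n ^ 2)%N by rewrite /x; nia.
have x0 : (0 < x)%N by nia.
have := congr1 (logn 5) x2.
by rewrite lognM ?expn_gt0 ?n0 // !lognX (_ : logn 5 5 = 1%N) //; lia.
Qed.

(** * Finite golden mean expansions *)

Definition golden_digits (f : nat -> nat) :=
  (forall j, f j = 0%N \/ f j = 1%N) /\ (forall j, (f j * f j.+1 = 0)%N).

Lemma golden_digits_shift f : golden_digits f -> golden_digits (f \o succn).
Proof. by case=> f01 ff; split=> j /=. Qed.

Lemma expansion_recl (K : comNzRingType) (x : K) (f : nat -> nat) m :
  \sum_(j < m.+1) (f j)%:R * x ^+ j =
  (f 0%N)%:R + x * \sum_(j < m) ((f \o succn) j)%:R * x ^+ j.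
Proof.
rewrite big_ord_recl expr0 mulr1 mulr_sumr; congr (_ + _).
by apply: eq_bigr => j _; rewrite /= exprS; ring.
Qed.

(** The coordinates p and q do not depend on which root x of x^2 = x + 1 is
    chosen, so the same pair describes an expansion in phi and its conjugate.
    They are natural numbers, and this is what makes the index n = p + 1
    positive in [digit_intervalP]. *)
Lemma expansion_lattice (f : nat -> nat) m :
  exists p q : nat, forall (K : comNzRingType) (x : K), x ^+ 2 = x + 1 ->
    \sum_(j < m) (f j)%:R * x ^+ j = p%:R * x + q%:R.
Proof.
elim: m f => [|m IHm] f.
  by exists 0%N, 0%N => K x _; rewrite big_ord0 mul0r addr0.
have [p [q pqE]] := IHm (f \o succn).
exists (p + q)%N, (p + f 0%N)%N => K x xx.
rewrite expansion_recl pqE // !natrD.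
have -> : x * (p%:R * x + q%:R) = p%:R * x ^+ 2 + q%:R * x by ring.
by rewrite xx; ring.
Qed.

(** As 1 - phi = -1 / phi, prepending a digit e maps S to e - S / phi.  The map
    sends ]-1, phi[ onto ]-1, phi - 1[ for e = 0; for e = 1 the next digit must
    be 0, and ]-1, phi - 1[ is sent onto ]phi - 1, phi[. *)
Lemma conj_expansion_bounds (R : realType) (f : nat -> nat) m :
  golden_digits f ->
  let S := \sum_(j < m.+1) (f j)%:R * (1 - phi R) ^+ j in
  (f 0%N = 0%N -> -1 < S < phi R - 1) /\
  (f 0%N = 1%N -> phi R - 1 < S < phi R).
Proof.
have /andP[f1 f2] := phi_bounds R; have ff := phi_sqr R.
elim: m f => [|m IHm] f fP /=.
  by rewrite big_ord1 expr0 mulr1; split=> ->; apply/andP; split; lra.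
have /= [S0 S1] := IHm _ (golden_digits_shift fP).
rewrite expansion_recl.
move: S0 S1 => /=; set S := (\sum_(j < m.+1) _) => S0 S1.
have [f01 f00] := fP.
split=> f0E; rewrite f0E.
  case: (f01 1%N) => f1E; [have := S0 f1E | have := S1 f1E];
    by move=> /andP[? ?]; apply/andP; split; nra.
have f1E : f 1%N = 0%N by have := f00 0%N; rewrite f0E mul1n.
by have /andP[? ?] := S0 f1E; apply/andP; split; nra.
Qed.

(** Here phi - 1 = 1 / phi is the base.  A leading 0 divides a value below phi
    by phi; a leading 1 is followed by a 0, and adds 1 to something below
    1 / phi. *)
Lemma tail_expansion_bounds (R : realType) (g : nat -> nat) m :
  golden_digits g ->
  let T := \sum_(j < m) (g j)%:R * (phi R - 1) ^+ j in
  0 <= T < phi R /\ (g 0%N = 0%N -> T < 1).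
Proof.
have /andP[f1 f2] := phi_bounds R; have ff := phi_sqr R.
elim: m g => [|m IHm] g gP /=.
  by rewrite big_ord0; split=> [|_]; [apply/andP; split|]; lra.
have /= [] := IHm _ (golden_digits_shift gP).
rewrite expansion_recl; set T := (\sum_(j < m) _) => /andP[T0 T1] Tlt1.
have [g01 gg] := gP.
case: (g01 0%N) => g0E; rewrite g0E.
  by split=> [|_]; [apply/andP; split|]; nra.
have /Tlt1 T1' : g 1%N = 0%N by have := gg 0%N; rewrite g0E mul1n.
by split=> //; apply/andP; split; nra.
Qed.

(** * Splitting a base phi representation at an index *)

Lemma int_finite_set_bounded (A : set int) :
  finite_set A -> exists M : nat, forall i, A i -> (`|i| < M)%N.
Proof.
move=> /finite_seqP[s ->]; exists (\max_(i <- s) absz i).+1 => i /= si.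
by rewrite ltnS; exact: (@leq_bigmax_seq _ s xpredT absz).
Qed.

(** The digits above and below the cut are indexed by natural numbers going away
    from it; one common length m bounds the support on both sides, and is
    positive so that the lowest digit of the upper part is always present. *)
Lemma base_phi_split (R : realType) (N : nat) (d : int -> nat) (k : nat) :
  base_phi_representation R N d ->
  exists m, N%:R = phi R ^+ k *
    (phi R * (\sum_(j < m.+1) (d (k.+1 + j)%N)%:R * phi R ^+ j) +
     \sum_(j < m.+1) (d (k%:Z - j%:Z))%:R * (phi R - 1) ^+ j).
Proof.
case=> d01 dd /int_finite_set_bounded[M dM] ->.
have /andP[f1 f2] := phi_bounds R; have ff := phi_sqr R.
have fN0 : phi R != 0 by apply/eqP => f0; move: f1; rewrite f0; lra.
(* The lower indices run down from k, so k more terms are needed to reach -M. *)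
exists (M + k)%N.
pose s := [seq (k.+1 + j)%N%:Z | j <- iota 0 (M + k).+1] ++
          [seq k%:Z - j%:Z | j <- iota 0 (M + k).+1].
have us : uniq s.
  rewrite cat_uniq !map_inj_uniq ?iota_uniq ?andbT; try by move=> ? ? /=; lia.
  by apply/hasPn => _ /mapP[j _ ->]; apply/mapP => -[i _]; lia.
rewrite (fsbigE s) //=; last first.
  move=> i _ nis; rewrite (_ : d i = 0%N) ?mul0r //; apply/eqP.
  apply: contraNT nis => /eqP /dM iM; rewrite mem_cat.
  have [ki|ik] := ltP k%:Z i; apply/orP; [left|right]; apply/mapP.
    by exists (`|i| - k.+1)%N; rewrite ?mem_iota; lia.
  by exists (absz (k%:Z - i)%R); rewrite ?mem_iota; lia.
rewrite (eq_bigl xpredT); last by move=> i; exact: mem_set.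
rewrite big_cat !big_map mulrDr !mulr_sumr.
rewrite -[iota 0 _]/(index_iota 0 (M + k).+1) !big_mkord; congr (_ + _).
  apply: eq_bigr => j _.
  by rewrite -exprnP exprD exprS; ring.
apply: eq_bigr => j _; rewrite expfzDr // -exprnP -exprnN.
have -> : phi R ^- j = (phi R - 1) ^+ j.
  by rewrite -exprVn; congr (_ ^+ _); field: ff.
by ring.
Qed.

(** * Digits and intervals *)

(** Since x - x' = u (2 phi - 1) lies in ]-1, 2 phi[, only u = 0 and u = 1 are
    possible.  Then v is pinned between two consecutive integers: the windows
    have the excluded values v = -1 and 0 for u = 0, v = -2 and -1 for u = 1,
    on their boundary, so the strictness of the bounds matters. *)
Lemma lattice_window_separation (R : realType) (u v : int) :
  let x := u%:~R * phi R + v%:~R in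
  let x' := u%:~R * (1 - phi R) + v%:~R in
  -1 < x < phi R - 1 -> -1 - phi R < x' < 0 -> False.
Proof.
have /andP[f1 f2] := phi_bounds R => /= /andP[x1 x2] /andP[y1 y2].
have u0 : 0 <= u.
  rewrite leNgt; apply/negP => un; have : u + 1 <= 0 by lia.
  by rewrite -(ler_int R) rmorphD /=; nra.
have u1 : u <= 1.
  rewrite leNgt; apply/negP => un; have : 2 <= u by lia.
  by rewrite -(ler_int R) /=; nra.
have /orP[/eqP uE|/eqP uE] : (u == 0) || (u == 1) by lia.
  move: x1 x2 y1 y2; rewrite uE !mul0r !add0r => x1 _ _ y2.
  have : -1 < v by rewrite -(ltr_int R).
  have : v < 0 by rewrite -(ltr_int R).
  lia.
move: x1 x2 y1 y2; rewrite uE !mul1r => _ x2 y1 _.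
have : v < -1 by rewrite -(ltr_int R) rmorphN /=; lra.
have : -2 < v by rewrite -(ltr_int R) rmorphN /=; lra.
lia.
Qed.

(** The value a - phi^k is phi^(k+1) a_n, where a_n = floor(n phi) + (n - 1) /
    phi is the n-th lattice point whose conjugate lies in the window of the
    expansions with lowest digit 1. *)
Lemma digit_intervalP (R : realType) (k N : nat) (d : int -> nat) :
  base_phi_representation R N d ->
  d k.+1 = 1%N <->
  exists2 n : nat, (1 <= n)%N &
    let a := phi R ^+ k.+1 * (Num.floor (n%:R * phi R))%:~R
             + n%:R * phi R ^+ k in
    a - phi R ^+ k <= N%:R < a.
Proof.
move=> hd; have [d01 dd _ _] := hd.
have /andP[f1 f2] := phi_bounds R; have ff := phi_sqr R.
have [m ->] := base_phi_split k hd.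
pose f j := d (k.+1 + j)%N; pose g (j : nat) := d (k%:Z - j%:Z).
have fP : golden_digits f.
  split=> j; first exact: d01.
  by have := dd (k.+1 + j)%N; rewrite -PoszD addn1 -addnS.
have gP : golden_digits g.
  split=> j; first exact: d01.
  have := dd (k%:Z - j.+1%:Z).
  by rewrite (_ : k%:Z - j.+1%:Z + 1 = k%:Z - j%:Z) 1?mulnC //; lia.
have [p [q pqE]] := expansion_lattice f m.+1.
have [S0 S1] := conj_expansion_bounds R m fP.
have [/andP[T0 T1] T2] := tail_expansion_bounds R m.+1 gP.
rewrite -/f (pqE _ _ (phi_sqr R)).
have psi_sqr : (1 - phi R) ^+ 2 = (1 - phi R) + 1 by ring: ff.
rewrite (pqE _ _ psi_sqr) in S0 S1.
set T := \sum_(j < m.+1) (d (k%:Z - j%:Z))%:R * (phi R - 1) ^+ j.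
rewrite -/T in T0 T1 T2.
have f0E : f 0%N = d k.+1 by rewrite /f addn0.
rewrite f0E in S0 S1.
have P0 : 0 < phi R ^+ k by rewrite exprn_gt0; lra.
have scaled (n : nat) (c : int) :
    let a := phi R ^+ k.+1 * c%:~R + n%:R * phi R ^+ k in
    (a - phi R ^+ k <= phi R ^+ k * (phi R * (p%:R * phi R + q%:R) + T) < a) =
    (phi R * c%:~R + n%:R - 1 <= phi R * (p%:R * phi R + q%:R) + T
       < phi R * c%:~R + n%:R).
  rewrite /= -[in RHS](ler_pM2l P0) -[in RHS](ltr_pM2l P0) exprS.
  by congr (_ && _); congr (_ _ _); ring.
split=> [dk1 | [n n1]].
  have {}/S1 /andP[w1 w2] := dk1.
  exists p.+1 => //=.
  (* The window for the conjugate of S says exactly that q + p is this floor. *)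
  have -> : Num.floor (p.+1%:R * phi R) = (q + p)%:Z.
    apply: floor_def; rewrite rmorphD /= -!pmulrn natrD -natr1.
    by apply/andP; split; lra.
  have /T2 T3 : g 0%N = 0%N.
    by rewrite /g subr0; have := dd k; rewrite -PoszD addn1 dk1 muln1.
  rewrite scaled -pmulrn natrD -natr1.
  have -> : phi R * (p%:R * phi R + q%:R) = phi R * (q%:R + p%:R) + p%:R.
    by ring: ff.
  by apply/andP; split; lra.
rewrite /= scaled.
have [dk0 | //] := d01 k.+1.
have {}/S0 /andP[w1 w2] := dk0.
have /andP[c1 c2] := floor_itv (n%:R * phi R).
move: c1 c2; set c := Num.floor _; rewrite rmorphD /= => c1 c2 /andP[i1 i2].
(* The coordinates of the difference S - a_n. *)
exfalso; apply: (@lattice_window_separation R (p%:Z - n%:Z + 1)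
                                              (q%:Z - c + n%:Z - 1)) => /=.
  rewrite !(rmorphD, rmorphB, rmorphN) /= -!pmulrn.
  set x := (X in -1 < X).
  have xE : phi R * x = phi R * (p%:R * phi R + q%:R)
                        - (phi R * c%:~R + n%:R - 1) by rewrite /x; ring: ff.
  have f0 : 0 < phi R by lra.
  by rewrite -(ltr_pM2l f0 (-1)) -(ltr_pM2l f0 x) xE; apply/andP; split; lra.
rewrite !(rmorphD, rmorphB, rmorphN) /= -!pmulrn.
by apply/andP; split; lra.
Qed.

(** * Lucas numbers *)

Lemma lucas_phi (R : realType) n :
  (lucas n)%:R = phi R ^+ n + (1 - phi R) ^+ n.
Proof.
suff [] : (lucas n)%:R = phi R ^+ n + (1 - phi R) ^+ n /\
  (lucas n.+1)%:R = phi R ^+ n.+1 + (1 - phi R) ^+ n.+1 by [].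
have ff := phi_sqr R; elim: n => [|n [IH1 IH2]].
  by split; rewrite /= ?expr0 ?expr1; ring.
split=> //; rewrite [lucas _]/(lucas n.+1 + lucas n)%N natrD IH1 IH2 !exprS.
by ring: ff.
Qed.

Lemma lucas_gt0 n : (0 < lucas n)%N.
Proof.
suff /andP[] : (0 < lucas n)%N && (0 < lucas n.+1)%N by [].
by elim: n => // n /andP[l0 l1] /=; rewrite l1 /= addn_gt0 l1.
Qed.

(** Both parities in one form: the remainders run from - L_k to 0 when k + 1 is
    even, and one unit is lost at each end when k + 1 is odd. *)
Lemma remainder_rangeE k (r : int) :
  (r1 k.+1 <= r <= r1 k.+1 + (size (lucas_interval k.+1))%:Z - 1) =
  (- (lucas k)%:Z + (odd k.+1)%:Z <= r < (~~ odd k.+1)%:Z).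
Proof.
have l0 := lucas_gt0 k; rewrite /r1 /lucas_interval.
have -> : lucas k.+2 = (lucas k.+1 + lucas k)%N by [].
by case: ifP => _; rewrite !size_iota /=; lia.
Qed.

(** Both perturbations of the integer endpoints, (1 - phi)^(k+1) t and
    (1 - phi)^(k+1) (t - phi), are nonzero, of opposite signs, and smaller than
    1 in absolute value, because (phi - 1)^(k+1) phi = (phi - 1)^k < 1.
    The sign of (1 - phi)^(k+1) tells which endpoints survive. *)
Lemma remainder_window (R : realType) k (t : R) (r : int) :
  (0 < k)%N -> 0 < t < 1 ->
  (- (lucas k)%:R + (1 - phi R) ^+ k.+1 * (t - phi R) <= r%:~R
     < (1 - phi R) ^+ k.+1 * t) =
  (- (lucas k)%:Z + (odd k.+1)%:Z <= r < (~~ odd k.+1)%:Z).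
Proof.
move=> k0 /andP[t0 t1].
have /andP[f1 f2] := phi_bounds R; have ff := phi_sqr R.
set L := lucas k.
have -> : 1 - phi R = - (phi R - 1) by ring.
rewrite exprNn -signr_odd.
set e := (phi R - 1) ^+ k.+1.
have e0 : 0 < e by rewrite exprn_gt0; lra.
have e1 : e * phi R < 1.
  have -> : e * phi R = (phi R - 1) ^+ k by rewrite /e exprS; ring: ff.
  by rewrite exprn_ilt1 -?lt0n //; lra.
case: (odd _) => /=; rewrite ?expr1 ?expr0.
  apply/andP/andP => -[].
    move=> lo hi; split.
      suff : - L%:Z < r by lia.
      by rewrite -(ltr_int R) rmorphN /= -!pmulrn; nra.
    by rewrite -(ltr_int R) /=; nra.
  move=> lo hi.
  have {}hi : r <= -1 by lia.
  move: lo hi; rewrite -!(ler_int R) !(rmorphD, rmorphN) /= -!pmulrn => lo hi.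
  by split; nra.
apply/andP/andP => -[].
  move=> lo hi; split.
    suff : - L%:Z - 1 < r by lia.
    by rewrite -(ltr_int R) !(rmorphD, rmorphN) /= -!pmulrn; nra.
  by rewrite -(ltr_int R) /=; nra.
move=> lo hi.
have {}hi : r <= 0 by lia.
move: lo hi; rewrite -!(ler_int R) !(rmorphD, rmorphN) /= -!pmulrn => lo hi.
by split; nra.
Qed.

(** Replacing phi^k by L_k - (1 - phi)^k in a leaves the error term
    (1 - phi)^(k+1) (n phi - m), the conjugates of phi^(k+1) m + n phi^k having
    combined; irrationality of phi makes the fractional part n phi - m
    positive. *)
Lemma lucas_intervalE (R : realType) (n k : nat) (N : int) :
  (0 < n)%N -> (0 < k)%N ->
  let m := Num.floor (n%:R * phi R) in
  let a := phi R ^+ k.+1 * m%:~R + n%:R * phi R ^+ k in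
  let r := N - (m * (lucas k.+1)%:Z + n%:Z * (lucas k)%:Z) in
  (a - phi R ^+ k <= N%:~R < a) =
  (r1 k.+1 <= r <= r1 k.+1 + (size (lucas_interval k.+1))%:Z - 1).
Proof.
move=> n0 k0 m a r; have ff := phi_sqr R.
pose t := n%:R * phi R - m%:~R.
have tP : 0 < t < 1.
  have /andP[m1 m2] := floor_itv (n%:R * phi R).
  rewrite -/m rmorphD /= in m1 m2.
  rewrite /t subr_gt0 lt_neqAle m1 andbT; apply/andP; split; last by lra.
  by apply/eqP => /esym; exact: phi_irrational.
rewrite remainder_rangeE -(remainder_window r k0 tP).
have aE : a = m%:~R * (lucas k.+1)%:R + n%:R * (lucas k)%:R
              + (1 - phi R) ^+ k.+1 * t.
  by rewrite !(lucas_phi R) /a /t !exprS; ring: ff.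
have rE : r%:~R = N%:~R - (m%:~R * (lucas k.+1)%:R + n%:R * (lucas k)%:R) :> R.
  by rewrite rmorphB rmorphD !rmorphM.
have phikE : phi R ^+ k = (lucas k)%:R + (1 - phi R) ^+ k.+1 * phi R.
  by rewrite (lucas_phi R) exprS; ring: ff.
rewrite rE {}aE {}phikE.
by congr (_ && _); apply/idP/idP; lra.
Qed.

Theorem theorem6p1 (R : realType) (k N : nat) (d : int -> nat)
  (hk : (2 <= k)%N) (hN : (1 <= N)%N)
  (hd : base_phi_representation R N d) :
  d k%:Z = 1%N <->
  exists2 r : int,
    r1 k <= r <= r1 k + (size (lucas_interval k))%:Z - 1 &
    exists2 n : nat, (1 <= n)%N &
      N%:Z = Num.floor (n%:R * phi R) * (lucas k)%:Z
             + n%:Z * (lucas k.-1)%:Z + r.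
Proof.
case: k hk => [//|k] k0.
rewrite (digit_intervalP k hd); split=> [[n n0] | [r rP [n n0 NE]]].
  rewrite /= [N%:R]pmulrn lucas_intervalE // => rP.
  by eexists; [exact: rP | exists n => //; rewrite addrC subrK].
exists n => //=; rewrite [N%:R]pmulrn lucas_intervalE // NE.
by rewrite /= addrAC subrr add0r.
Qed.
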